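(* Let $n\geqslant 2$ be an integer. (1) If $(X,F)$ is an $n$-ary IN-semigroup, then $n$ is odd. Moreover, if $(X^*,F^* )$, with $X^*=X\cup\{e\}$ and $e\notin X$, is an $n$-ary semigroup obtained from $(X,F)$ by adjoining the neutral element $e$, then the binary structure $(X^*,\ast)$ defined by $$x\ast y = F^*(x,e^{n-2},y)\qquad (x,y\in X^* )$$ is a W-monoid with neutral element $e$, and $(X^*,F^* )$ is the $n$-ary extension of $(X^*,\ast)$, i.e. $F^*(x_1,\ldots,x_n)=x_1\ast\cdots\ast x_n$ for all $x_1,\ldots,x_n\in X^*$. Moreover, $(X^*,\ast)$ is the only monoid on $X^*$ with neutral element $e$ whose $n$-ary extension is $(X^*,F^* )$. (2) Conversely, let $(M,\ast)$ be any W-monoid with neutral element $e$, and let $F^*\colon M^n\to M$ be its $n$-ary extension, defined by $$F^*(x_1,\ldots,x_n)=x_1\ast\cdots\ast x_n\qquad (x_1,\ldots,x_n\in M).$$ If $n$ is odd, then, with $X=M\setminus\{e\}$, the set $X$ is closed under $F^*$ and $(X,F^*|_{X^n})$ is an $n$-ary IN-semigroup.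
   Context: An $n$-ary semigroup is a pair $(X,F)$, where $X$ is a nonempty set and $F\colon X^n\to X$ is associative, i.e. $$F(x_1,\ldots,x_{i-1},F(x_i,\ldots,x_{i+n-1}),x_{i+n},\ldots,x_{2n-1})=F(x_1,\ldots,x_i,F(x_{i+1},\ldots,x_{i+n}),x_{i+n+1},\ldots,x_{2n-1})$$ for all $x_1,\ldots,x_{2n-1}\in X$ and all $1\leqslant i\leqslant n-1$. $(X,F)$ is reducible to a (binary) semigroup $(X,\circ)$ on the same set if $F(x_1,\ldots,x_n)=x_1\circ x_2\circ\cdots\circ x_n$ for all $x_1,\ldots,x_n\in X$. It is reducible if it is reducible to some semigroup $(X,\circ)$, and irreducible otherwise. The notation $x^k$ in an argument list denotes $x,\ldots,x$ with $k$ copies of $x$ (an empty list if $k=0$). An element $e\in X$ is neutral for $F$ if $F(e^{k-1},x,e^{n-k})=x$ for every $x\in X$ and every $k\in\{1,\ldots,n\}$. A neutral element can be adjoined to $(X,F)$ if there exists an $n$-ary semigroup $(X^*,F^* )$, where $X^*=X\cup\{e\}$ for some $e\notin X$, such that $F^*|_{X^n}=F$ and $e$ is neutral for $F^*$; such an $(X^*,F^* )$ is said to be obtained from $(X,F)$ by adjoining the neutral element $e$. An $n$-ary IN-semigroup is an $n$-ary semigroup that is irreducible and to which a neutral element can be adjoined. A W-monoid is a (binary) semigroup $(M,\ast)$ with a neutral element $e$ for which there exists an element $a\in M$ such that: (W1) for any $x,y\in M$, $x\ast y=e$ if and only if ($x=a$ and $y=a$) or ($x=e$ and $y=e$); (W2)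 for any $x,y\in M$, $x\ast y=a$ if and only if ($x=a$ and $y=e$) or ($x=e$ and $y=a$); (W3) $a$ is noncentral for $\ast$, i.e. there is $x\in M$ with $a\ast x\neq x\ast a$. *)

(* Defs.v *)
From mathcomp Require Import all_boot.

Set Implicit Arguments.
Unset Strict Implicit.
Unset Printing Implicit Defensive.

(* Argument positions are numbered from 0, and an n-ary operation on X is a
   function n.-tuple X -> X. *)

(* F(x_0, ..., x_(i-1), F(x_i, ..., x_(i+n-1)), x_(i+n), ..., x_(2n-2)); only
   the first 2n-1 values of the sequence x are used when i < n. *)
Definition nested (X : Type) (n : nat) (F : n.-tuple X -> X)
    (x : nat -> X) (i : nat) : X :=
  F [tuple if j < i then x j
           else if j == i :> nat then F [tuple x (i + k) | k < n]
           else x (j + n.-1) | j < n].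

Definition nary_associative (X : Type) (n : nat) (F : n.-tuple X -> X) : Prop :=
  forall (x : nat -> X) (i : nat), i.+1 < n -> nested F x i = nested F x i.+1.

Definition nary_semigroup (X : Type) (n : nat) (F : n.-tuple X -> X) : Prop :=
  inhabited X /\ nary_associative F.

(* x_0 * x_1 * ... * x_(n-1), bracketed to the left; no neutral element is
   needed because n > 0. *)
Definition nary_ext (X : Type) (n : nat) (hn : 2 <= n) (op : X -> X -> X)
    (t : n.-tuple X) : X :=
  foldl op (tnth t (Ordinal (ltnW hn))) (behead t).

Definition reducible (X : Type) (n : nat) (hn : 2 <= n)
    (F : n.-tuple X -> X) : Prop :=
  exists op : X -> X -> X, associative op /\ forall t, F t = nary_ext hn op t.

Definition nary_neutral (X : Type) (n : nat) (F : n.-tuple X -> X)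
    (e : X) : Prop :=
  forall (x : X) (k : 'I_n), F [tuple if j == k then x else e | j < n] = x.

(* (Y, G) is obtained from (X, F) by adjoining the neutral element e. The
   injection i, whose image is Y minus e, identifies Y with the disjoint union
   of X and {e}. *)
Record adjoining (X : Type) (n : nat) (F : n.-tuple X -> X)
    (Y : Type) (i : X -> Y) (e : Y) (G : n.-tuple Y -> Y) : Prop := Adjoining {
  adjoining_inj : injective i;
  adjoining_new : forall x, i x <> e;
  adjoining_cover : forall y, y = e \/ exists x, y = i x;
  adjoining_semigroup : nary_semigroup G;
  adjoining_restr : forall t : n.-tuple X, G (map_tuple i t) = i (F t);
  adjoining_neutral : nary_neutral G e
}.

Definition adjoinable (X : Type) (n : nat) (F : n.-tuple X -> X) : Prop :=
  exists (Y : Type) (i : X -> Y) (e : Y) (G : n.-tuple Y -> Y),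
    adjoining F i e G.

Definition IN_semigroup (X : Type) (n : nat) (hn : 2 <= n)
    (F : n.-tuple X -> X) : Prop :=
  [/\ nary_semigroup F, ~ reducible hn F & adjoinable F].

Definition is_monoid (M : Type) (op : M -> M -> M) (e : M) : Prop :=
  [/\ associative op, left_id e op & right_id e op].

Definition W_monoid (M : Type) (op : M -> M -> M) (e : M) : Prop :=
  is_monoid op e /\
  exists a : M,
    [/\ forall x y, op x y = e <-> (x = a /\ y = a) \/ (x = e /\ y = e),
        forall x y, op x y = a <-> (x = a /\ y = e) \/ (x = e /\ y = a)
      & exists x, op a x <> op x a].

(* x * y = F(x, e, ..., e, y), with n - 2 copies of e *)
Definition derived_op (X : Type) (n : nat) (F : n.-tuple X -> X) (e : X)
    (x y : X) : X :=
  F [tuple if j == 0 :> nat then x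
           else if j == n.-1 :> nat then y else e | j < n].

Definition closed_under (X : Type) (n : nat) (P : X -> Prop)
    (F : n.-tuple X -> X) : Prop :=
  forall t : n.-tuple X, (forall j, P (tnth t j)) -> P (F t).

Lemma tnth_svalP (X : Type) (n : nat) (P : X -> Prop)
    (t : n.-tuple {x : X | P x}) (j : 'I_n) : P (tnth (map_tuple sval t) j).
Proof. by rewrite tnth_map; apply: svalP. Qed.

Definition restrict_op (X : Type) (n : nat) (P : X -> Prop)
    (F : n.-tuple X -> X) (hF : closed_under P F)
    (t : n.-tuple {x : X | P x}) : {x : X | P x} :=
  exist P (F (map_tuple sval t)) (hF _ (tnth_svalP t)).

(* Main.v *)
From Stdlib Require Import List ClassicalEpsilon ProofIrrelevance.
Require Import Defs.
From mathcomp Require Import all_boot zify.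

Set Implicit Arguments.
Unset Strict Implicit.
Unset Printing Implicit Defensive.

(** In an n-ary semigroup G with a neutral element e, associativity lets e be
    exchanged with either neighbour (neutral_swap) and lets two adjacent
    entries x, y be replaced by x * y, e, where x * y = G(x, e, ..., e, y)
    (derived_op_merge). Merging repeatedly shows that G is the n-ary extension
    of * (nary_ext_derived_op), and sliding an inner bracket through
    x, e, ..., e, y, e, ..., e, z shows that * is associative.

    Let now G be obtained from an irreducible F on X by adjoining e. If * mapped
    X * X into X, it would reduce F, so a * b = e for some a, b other than e.
    On the other hand, X is closed under G, so no product of n elements other
    than e equals e. Appending the factors a, b to a product does not change it,
    so this property descends from n to n - 2, n - 4, ... For even n it would
    descend to the empty product, which is e; for odd n it descends to 3, and
    then short computations with three factors show that b = a is the only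
    element other than e involved in a factorization of e, and that a has only
    trivial factorizations (avoids3_W_element). If a were central, then
    x * a * y would be an associative operation on X, and since a * a = e and
    n - 1 is even, it would reduce F; so a is noncentral.

    Conversely, in a W-monoid a product of k elements other than e can be e only
    for even k and a only for odd k (W_element_parity), which for odd n makes
    the complement of e closed. If an operation o on this complement reduced F,
    then the (n-1)-fold o-power u of a would be neutral for o because
    x * a^(n-1) = x, hence neutral for F. From F(u, ..., u, a) = a, conditions
    (W2) and (W1) give u = a. But then F(a, x, a, ..., a) = x says that
    a * x * a = x, that is, a commutes with every x, which contradicts (W3). *)

(** * Operations on tuples evaluated at sequences *)

(** Evaluating F at a plain sequence avoids size proofs inside terms, so that
    entries can be moved by rewriting; d is a dummy value, used only when the
    size of s is not n. *)
Definition on_seq (X : Type) (n : nat) (F : n.-tuple X -> X) (d : n.-tuple X)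
  (s : seq X) : X := F (insubd d s).

Section OnSeq.

Variables (X : Type) (n : nat) (F : n.-tuple X -> X) (d : n.-tuple X).

Lemma on_seqE (t : n.-tuple X) s : val t = s -> F t = on_seq F d s.
Proof. by move=> <-; rewrite /on_seq valKd. Qed.

Lemma val_mktuple (f : 'I_n -> X) z (s : seq X) :
  size s = n -> (forall j, f j = nth z s j) -> val (mktuple f) = s.
Proof.
move=> hs hf; apply: (@eq_from_nth _ z); first by rewrite size_tuple.
move=> j; rewrite size_tuple => hj.
exact: etrans (nth_mktuple f z (Ordinal hj)) (hf _).
Qed.

(** The n-ary associativity law becomes a statement about concatenations, which
    can then be matched against words built from blocks of e. *)
Lemma nested_on_seq x i : i < n ->
  nested F x i = on_seq F d (map x (iota 0 i) ++
    on_seq F d (map x (iota i n)) :: map x (iota (i + n) (n.-1 - i))).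
Proof.
move=> hi; apply/on_seqE/(@val_mktuple _ (x 0)).
  by rewrite size_cat /= !size_map !size_iota; lia.
move=> j; have hj := ltn_ord j; rewrite nth_cat size_map size_iota.
case: ltnP => [lt_ji|le_ij].
  by rewrite (nth_map 0) ?size_iota // nth_iota.
case: eqP => [->|/eqP ne_ji].
  rewrite subnn /=; apply: on_seqE; apply: (@val_mktuple _ (x 0)).
    by rewrite size_map size_iota.
  by move=> k; rewrite (nth_map 0) ?size_iota // nth_iota.
have -> : j - i = (j - i).-1.+1 by lia.
by rewrite /= (nth_map 0) ?size_iota ?nth_iota; [congr x|..]; lia.
Qed.

Lemma neutral_on_seq e : nary_neutral F e <->
  forall x k, k < n -> on_seq F d (nseq k e ++ x :: nseq (n.-1 - k) e) = x.
Proof.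
suff eqF x (k : 'I_n) : F [tuple if j == k then x else e | j < n] =
    on_seq F d (nseq k e ++ x :: nseq (n.-1 - k) e).
  split=> [h x k hk|h x k]; last by rewrite eqF h.
  by rewrite -(eqF x (Ordinal hk)) h.
have hk := ltn_ord k.
apply/on_seqE/(@val_mktuple _ e); first by rewrite size_cat /= !size_nseq; lia.
move=> j; rewrite nth_cat size_nseq -val_eqE /=.
case: (ltngtP j k) => [ltjk|ltkj|->]; last by rewrite subnn.
  by rewrite nth_nseq if_same.
have -> : j - k = (j - k).-1.+1 by lia.
by rewrite /= nth_nseq if_same.
Qed.

Lemma derived_on_seq e x y : 2 <= n ->
  derived_op F e x y = on_seq F d (x :: nseq n.-2 e ++ [:: y]).
Proof.
move=> hn; apply/on_seqE/(@val_mktuple _ e).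
  by rewrite /= size_cat size_nseq /=; lia.
case=> -[|j] hj //=; rewrite nth_cat size_nseq nth_nseq if_same.
have -> : (j.+1 == n.-1) = (j == n.-2) by lia.
case: ltngtP => [//| |->]; [lia|by rewrite subnn].
Qed.

(** The elementary step of associativity: an inner bracket moves by one place.
    It is the law applied to the word u, x, v, y, w at the position of x. *)
Lemma associative_on_seq u v w x y : nary_associative F ->
  size v = n.-1 -> size u + size w + 2 = n ->
  on_seq F d (u ++ on_seq F d (x :: v) :: y :: w) =
  on_seq F d (u ++ x :: on_seq F d (rcons v y) :: w).
Proof.
move=> assF hv huw; pose l := u ++ x :: v ++ y :: w.
have hl : size l = n + n.-1 by rewrite size_cat /= size_cat /=; lia.
have := assF (nth x l) (size u); rewrite !nested_on_seq; try lia.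
have e1 : (size u).+1 = size (rcons u x) by rewrite size_rcons.
have e2 : size u + n = size (u ++ x :: v) by rewrite size_cat /=; lia.
have e3 : (size u).+1 + n = size (u ++ x :: rcons v y).
  by rewrite size_cat /= size_rcons; lia.
have l1 : l = rcons u x ++ (rcons v y ++ w) by rewrite cat_rcons /= cat_rcons.
have l2 : l = (u ++ x :: v) ++ y :: w by rewrite -catA.
have l3 : l = (u ++ x :: rcons v y) ++ w by rewrite -catA /= cat_rcons.
have [s1 s2] : size (x :: v) = n /\ size (rcons v y) = n.
  by rewrite size_rcons /=; lia.
have E1 : take (size u) l = u by rewrite take_size_cat.
have E2 : take (size u).+1 l = rcons u x by rewrite l1 e1 take_size_cat.
have E3 : take n (drop (size u) l) = x :: v.
  by rewrite drop_size_cat // -cat_cons take_size_cat.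
have E4 : take n (drop (size u).+1 l) = rcons v y.
  by rewrite l1 e1 drop_size_cat // take_size_cat.
have E5 : take (n.-1 - size u) (drop (size u + n) l) = y :: w.
  by rewrite e2 l2 drop_size_cat // take_oversize //=; lia.
have E6 : take (n.-1 - (size u).+1) (drop ((size u).+1 + n) l) = w.
  by rewrite e3 l3 drop_size_cat // take_oversize //=; lia.
rewrite !map_nth_iota; try lia.
by rewrite !drop0 E1 E2 E3 E4 E5 E6 cat_rcons; apply; lia.
Qed.

End OnSeq.

Lemma map_on_seq (X Y : Type) n (F : n.-tuple X -> X) (G : n.-tuple Y -> Y)
    (i : X -> Y) d d' s :
  (forall t, G (map_tuple i t) = i (F t)) -> size s = n ->
  i (on_seq F d s) = on_seq G d' (map i s).
Proof.
move=> GF /eqP hs; rewrite -(on_seqE F d (t := Tuple hs)) // -GF.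
exact: on_seqE.
Qed.

Lemma tuple_gt0_cons (X : Type) n (t : n.-tuple X) :
  0 < n -> exists x s, t = x :: s :> seq X.
Proof. by case: t => -[|x s] /= /eqP <- // _; exists x, s. Qed.

Lemma foldl_op (T : Type) (op : T -> T -> T) : associative op ->
  forall x y s, foldl op (op x y) s = op x (foldl op y s).
Proof. by move=> opA x y s; elim: s y => //= z s IH y; rewrite -opA IH. Qed.

Lemma nary_ext_val (X : Type) n (hn : 2 <= n) op (t : n.-tuple X) x s :
  t = x :: s :> seq X -> nary_ext hn op t = foldl op x s.
Proof.
by move=> ht; rewrite /nary_ext (tnth_nth x) ht.
Qed.

Lemma nary_ext_on_seq (X : Type) n (hn : 2 <= n) op (d : n.-tuple X) x s :
  size s = n.-1 -> on_seq (nary_ext hn op) d (x :: s) = foldl op x s.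
Proof.
move=> hs; have h : size (x :: s) == n by rewrite /= hs; apply/eqP; lia.
by rewrite -(on_seqE _ d (t := Tuple h)) //; apply: nary_ext_val.
Qed.

(** * n-ary extensions of monoids *)

Section Products.

Variables (M : Type) (op : M -> M -> M) (e : M).
Hypothesis opM : is_monoid op e.

Lemma foldl_monoid x s : foldl op x s = op x (foldl op e s).
Proof. by have [opA op1 opr1] := opM; rewrite -foldl_op // opr1. Qed.

Lemma foldl_nseq x k : foldl op x (nseq k e) = x.
Proof. by have [opA op1 opr1] := opM; elim: k => //= k; rewrite opr1. Qed.

Lemma nary_ext_monoid n (hn : 2 <= n) t : nary_ext hn op t = foldl op e t.
Proof.
have [opA op1 opr1] := opM.
have [x [s et]] := tuple_gt0_cons t (ltnW hn).
by rewrite (nary_ext_val _ _ et) et /= op1.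
Qed.

Lemma monoid_on_seq n (hn : 2 <= n) d s : size s = n ->
  on_seq (nary_ext hn op) d s = foldl op e s.
Proof.
have [opA op1 opr1] := opM.
case: s => [|x s] /= hs; first lia.
by rewrite nary_ext_on_seq ?op1 //; lia.
Qed.

(** Wherever the inner bracket stands, the nested value is the product of the
    whole word of length 2n - 1. *)
Lemma nary_ext_associative n (hn : 2 <= n) : nary_associative (nary_ext hn op).
Proof.
have [opA op1 opr1] := opM => x i hi.
pose d := nseq_tuple n e.
suff nestedE j : j < n ->
    nested (nary_ext hn op) x j = foldl op e (map x (iota 0 (n + n.-1))).
  by rewrite !nestedE //; lia.
have hs : size (map x (iota j n)) = n by rewrite size_map size_iota.
move=> hj; rewrite (nested_on_seq _ d) // (monoid_on_seq hn d hs).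
rewrite monoid_on_seq; last by rewrite size_cat /= !size_map !size_iota; lia.
have -> : n + n.-1 = j + (n + (n.-1 - j)) by lia.
rewrite !iotaD !map_cat !foldl_cat /= add0n.
by rewrite -foldl_monoid.
Qed.

Lemma nary_ext_neutral n (hn : 2 <= n) : nary_neutral (nary_ext hn op) e.
Proof.
have [opA op1 opr1] := opM.
apply/(neutral_on_seq _ (nseq_tuple n e)) => x k hk.
rewrite monoid_on_seq ?size_cat /= ?size_nseq; last lia.
by rewrite foldl_cat foldl_nseq /= op1 foldl_nseq.
Qed.

Lemma derived_op_nary_ext n (hn : 2 <= n) x y :
  derived_op (nary_ext hn op) e x y = op x y.
Proof.
have [opA op1 opr1] := opM.
rewrite (derived_on_seq _ (nseq_tuple n e)) // nary_ext_on_seq.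
  by rewrite foldl_cat foldl_nseq.
by rewrite size_cat size_nseq /=; lia.
Qed.

End Products.

(** * Reduction of an n-ary semigroup with a neutral element *)

Section Reduction.

Variables (Y : Type) (n : nat) (hn : 2 <= n) (G : n.-tuple Y -> Y) (e : Y).
Hypotheses (assG : nary_associative G) (neutG : nary_neutral G e).

Let d := nseq_tuple n e.
Local Notation L := (on_seq G d).
Local Notation op := (derived_op G e).

Lemma neutral_seq x k l : k + l = n.-1 -> L (nseq k e ++ x :: nseq l e) = x.
Proof.
move=> hkl; have := (neutral_on_seq G d e).1 neutG x k.
have -> : n.-1 - k = l by lia.
by apply; lia.
Qed.

(** Both sides come from the word u, e, x, e, ..., e, w with n - 1 copies of e
    after x: a bracket of length n absorbs its n - 1 copies of e and leaves x,
    and it can be placed at the first e or at x. *)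
Lemma neutral_swap u w x : size u + size w + 2 = n ->
  L (u ++ e :: x :: w) = L (u ++ x :: e :: w).
Proof.
move=> huw; have hm : n.-1 = n.-2.+1 by lia.
have hx : L (x :: nseq n.-2 e ++ [:: e]) = x.
  by rewrite -(nseqD _ 1) addn1 -hm; apply: (@neutral_seq x 0).
have hx' : L [:: e, x & nseq n.-2 e] = x by apply: (@neutral_seq x 1); lia.
have := @associative_on_seq _ _ G d u (x :: nseq n.-2 e) w e e assG.
by rewrite rcons_cons -cats1 hx hx' /= size_nseq => ->.
Qed.

Lemma neutral_swap_nseq u w x k : size u + size w + k + 1 = n ->
  L (u ++ nseq k e ++ x :: w) = L (u ++ x :: nseq k e ++ w).
Proof.
elim: k u => [//|k IH] u huw /=.
have := IH (rcons u e); rewrite !cat_rcons => ->.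
  2: by rewrite size_rcons; lia.
by rewrite neutral_swap // size_cat size_nseq; lia.
Qed.

(** In the word x, e, ..., e, y, e, s with n - 2 copies of e before y, a bracket
    at the beginning produces op x y, and the next one produces y. *)
Lemma derived_op_merge s x y : size s = n.-2 ->
  L [:: x, y & s] = L [:: op x y, e & s].
Proof.
move=> hs; rewrite (derived_on_seq _ d) //.
have := @associative_on_seq _ _ G d [::] (nseq n.-2 e ++ [:: y]) s x e assG.
rewrite /= size_cat size_nseq /= => ->; try lia.
rewrite rcons_cat /=; congr (L [:: _, _ & _]).
by apply/esym/(@neutral_seq y n.-2 1); lia.
Qed.

(** Each merge uses up one entry of s and releases one e, which joins the block
    of e behind the accumulated product; hence the block in the statement. *)
Lemma on_seq_derived_op s x k : k + size s = n.-1 ->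
  L (x :: nseq k e ++ s) = foldl op x s.
Proof.
elim: s x k => [|y s IH] x k /= hk.
  by rewrite cats0; apply: (@neutral_seq x 0); lia.
rewrite (@neutral_swap_nseq [:: x]) /=; last by lia.
rewrite derived_op_merge; last by rewrite size_cat size_nseq; lia.
by apply: (IH _ k.+1); lia.
Qed.

(** An inner bracket slides all the way to the left, one place at a time. *)
Lemma on_seq_shift u v w : size v = n -> size u + size w + 1 = n ->
  L (u ++ L v :: w) = L (L (take n (u ++ v ++ w)) :: drop n (u ++ v ++ w)).
Proof.
elim/last_ind: u v w => [|u x IH] v w hv huw.
  by rewrite /= take_size_cat ?drop_size_cat.
case/lastP: v hv => [/= n0|v y]; first by lia.
move: huw; rewrite !size_rcons => huw hv.
rewrite cat_rcons -(associative_on_seq (F := G)) //; try lia.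
by rewrite (IH (x :: v)) /= ?cat_rcons /=; try lia.
Qed.

Lemma derived_op_monoid : is_monoid op e.
Proof.
have opE x y : op x y = L (x :: nseq n.-2 e ++ [:: y]) by apply: derived_on_seq.
split=> [x y z|x|x]; last 2 first.
- by rewrite opE; apply: (@neutral_seq x n.-2.+1 0); lia.
- by rewrite opE -(nseqD _ 1); apply: (@neutral_seq x 0); lia.
(* Both bracketings of x, y, z evaluate the word
   x, e^(n-2), y, e^(n-2), z of length 2n - 1. *)
pose v := x :: nseq n.-2 e.
have hv : size v = n.-1 by rewrite /= size_nseq; lia.
rewrite (opE x (op y z)) -cat_cons -/v (opE y) on_seq_shift; first last.
- by rewrite hv /=; lia.
- by rewrite /= size_cat size_nseq /=; lia.
have -> : v ++ (y :: nseq n.-2 e ++ [:: z]) ++ [::] =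
          rcons v y ++ (nseq n.-2 e ++ [:: z]) by rewrite cats0 cat_rcons.
rewrite take_size_cat ?drop_size_cat ?size_rcons ?hv; try lia.
by rewrite -cats1 -opE -[L (v ++ _)]opE.
Qed.

Theorem nary_ext_derived_op t : G t = nary_ext hn op t.
Proof.
have [x [s et]] := tuple_gt0_cons t (ltnW hn).
rewrite (nary_ext_val _ _ et) (on_seqE G d et).
have := size_tuple t; rewrite et /= => hs.
by rewrite -(@on_seq_derived_op s x 0) //; lia.
Qed.

End Reduction.

(** * Products of non-neutral elements *)

Section Words.

Variables (M : Type) (op : M -> M -> M) (e : M).
Hypothesis opM : is_monoid op e.

Definition avoids_neutral k := forall s : seq M, size s = k ->
  List.Forall (fun x => x <> e) s -> foldl op e s <> e.

(** Appending the factors a, b to a word leaves its product unchanged. *)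
Lemma avoids_neutral_cancel a b k : a <> e -> b <> e -> op a b = e ->
  avoids_neutral k.+2 -> avoids_neutral k.
Proof.
have [opA op1 opr1] := opM => ae be ab avoid s hs Hs.
have := avoid (s ++ [:: a; b]); rewrite size_cat foldl_cat /= -opA ab opr1.
by apply; [lia|apply/List.Forall_app; split=> //; repeat constructor].
Qed.

Lemma avoids_neutral_descend a b k m : a <> e -> b <> e -> op a b = e ->
  avoids_neutral (k + m.*2) -> avoids_neutral k.
Proof.
move=> ae be ab; elim: m => [|m IH]; first by rewrite addn0.
by rewrite doubleS !addnS => /(avoids_neutral_cancel ae be ab).
Qed.

(** For even n the property would descend to the empty word, whose product
    is e. *)
Lemma avoids_neutral_odd a b n : a <> e -> b <> e -> op a b = e ->
  avoids_neutral n -> odd n.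
Proof.
move=> ae be ab avoid; case: (boolP (odd n)) => // even_n.
have en : n = 0 + n./2.*2 by lia.
rewrite en in avoid.
by case: (avoids_neutral_descend ae be ab avoid (s := [::])).
Qed.

(** Conditions (W1) and (W2) on the element a of a W-monoid, separated from its
    noncentrality. *)
Definition W_element a :=
  (forall x y, op x y = e <-> (x = a /\ y = a) \/ (x = e /\ y = e)) /\
  (forall x y, op x y = a <-> (x = a /\ y = e) \/ (x = e /\ y = a)).

(** Every failure of (W1) or (W2) produces three elements other than e with
    product e: if p q = e and p p <> e, take p p, q, q; if p p = a a = e and
    p <> a, take p a, a, p; if x y = a with x, y <> e, take x, y, a. *)
Lemma avoids3_W_element a b : a <> e -> b <> e -> op a b = e ->
  avoids_neutral 3 -> W_element a.
Proof.
have [opA op1 opr1] := opM => ae be ab avoid.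
have tri p q r : p <> e -> q <> e -> r <> e -> op (op p q) r <> e.
  move=> pe qe re; rewrite -{1}(op1 p); apply: (avoid [:: p; q; r]) => //.
  by repeat constructor.
have invol p q : p <> e -> q <> e -> op p q = e -> op p p = e.
  move=> pe qe pq; case: (classic (op p p = e)) => // ppe.
  by case: (tri _ _ _ ppe qe qe); rewrite -(opA p) pq opr1.
have aa := invol _ _ ae be ab.
have uniq_invol p : p <> e -> op p p = e -> p = a.
  move=> pe pp; case: (classic (op p a = e)) => [pa|pae].
    by rewrite -(opr1 p) -aa opA pa op1.
  by case: (tri _ _ _ pae ae pe); rewrite -(opA p) aa opr1.
split=> x y; split.
- move=> xy; case: (classic (x = e)) => [xe|xe].
    by right; split=> //; rewrite -xy xe op1.
  have ye : y <> e by move=> ye; apply: xe; rewrite -xy ye opr1.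
  have xa : x = a by apply: uniq_invol => //; apply: invol xe ye xy.
  by left; split=> //; rewrite -(op1 y) -aa -opA -{2}xa xy opr1.
- by case=> [[-> ->] //|[-> ->]]; rewrite op1.
- move=> xy; case: (classic (x = e)) => [xe|xe].
    by right; split=> //; rewrite -xy xe op1.
  case: (classic (y = e)) => [ye|ye]; first by left; rewrite -xy ye opr1.
  by case: (tri _ _ _ xe ye ae); rewrite xy.
- by case=> [[-> ->]|[-> ->]]; rewrite ?op1 ?opr1.
Qed.

(** By (W1) and (W2), the last factor of a product equal to e or a, when it is
    not e, is a, and the product of the remaining factors is a or e
    respectively; so the two values alternate with the length. *)
Lemma W_element_parity a : W_element a -> a <> e -> forall s : seq M,
  List.Forall (fun x => x <> e) s ->
  (foldl op e s = e -> ~~ odd (size s)) /\ (foldl op e s = a -> odd (size s)).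
Proof.
move=> [W1 W2] ae; elim/last_ind => [_|s x IH].
  by split=> // /= ea; case: ae.
rewrite -cats1 => /List.Forall_app [/IH [He Ha] /List.Forall_cons_iff [xe _]].
rewrite cats1 size_rcons foldl_rcons /=; split.
  by move/W1 => [[/Ha -> //]|[_ /xe]].
by move/W2 => [[_ /xe //]|[/He]].
Qed.

(** The operation that would reduce F if a were central: it preserves the set of
    elements other than e as soon as products of three of them avoid e. *)
Definition twist a x y := op (op x a) y.

Lemma twist_associative a : associative (twist a).
Proof. by have [opA _ _] := opM => x y z; rewrite /twist !opA. Qed.

Lemma foldl_twist a x s : (forall y, op a y = op y a) -> op a a = e ->
  foldl (twist a) x s = op (foldl op x s) (if odd (size s) then a else e).
Proof.
have [opA op1 opr1] := opM => ca aa.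
elim: s x => [|y s IH] x /=; first by rewrite opr1.
rewrite IH /twist -(opA x) ca opA (foldl_monoid opM) [in RHS](foldl_monoid opM).
rewrite -(opA (op x y)) ca -!opA; do 3!congr op.
by case: (odd _) => /=; rewrite ?aa ?opr1.
Qed.

End Words.

(** * Transfer along an injection *)

Lemma reducible_pullback (X Y : Type) n (hn : 2 <= n) (F : n.-tuple X -> X)
    (i : X -> Y) (op : Y -> Y -> Y) :
  injective i -> associative op ->
  (forall x y, exists z, op (i x) (i y) = i z) ->
  (forall t, nary_ext hn op (map_tuple i t) = i (F t)) -> reducible hn F.
Proof.
move=> inji opA clos Fop.
pose opX x y := sval (constructive_indefinite_description _ (clos x y)).
have hX x y : op (i x) (i y) = i (opX x y).
  exact: svalP (constructive_indefinite_description _ (clos x y)).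
exists opX; split=> [x y z|t].
  by apply: inji; rewrite -!hX opA.
apply: inji; rewrite -Fop.
have [x [s et]] := tuple_gt0_cons t (ltnW hn).
rewrite (nary_ext_val _ _ et) (@nary_ext_val _ _ _ _ _ (i x) (map i s)).
  2: by rewrite /= et.
by elim: s x {et} => //= y s IH x; rewrite hX IH.
Qed.

Lemma associative_pullback (X Y : Type) n (F : n.-tuple X -> X)
    (G : n.-tuple Y -> Y) (i : X -> Y) : injective i ->
  (forall t, G (map_tuple i t) = i (F t)) ->
  nary_associative G -> nary_associative F.
Proof.
move=> inji GF assG x j hj; apply: inji.
have nestE k : i (nested F x k) = nested G (i \o x) k.
  rewrite /nested -GF; congr G; apply: eq_from_tnth => l.
  rewrite tnth_map !tnth_mktuple; case: ifP => // _; case: ifP => // _.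
  rewrite -GF; congr G; apply: eq_from_tnth => m.
  by rewrite tnth_map !tnth_mktuple.
by rewrite !nestE assG.
Qed.

Lemma Forall_image (X Y : Type) (i : X -> Y) e (s : seq Y) :
  (forall y, y = e \/ exists x, y = i x) ->
  List.Forall (fun y => y <> e) s -> exists r, s = map i r.
Proof.
move=> cover; elim=> [|y {}s ye _ [r ->]]; first by exists [::].
by case: (cover y) => // -[x ->]; exists (x :: r).
Qed.

Lemma Forall_tnth (X : Type) n (t : n.-tuple X) (P : X -> Prop) :
  (forall j, P (tnth t j)) -> List.Forall P t.
Proof.
case: n t => [|n] t Pt; first by rewrite tuple0.
have {Pt} : forall j, j < size t -> P (nth (thead t) t j).
  by move=> j; rewrite size_tuple => hj; rewrite -(tnth_nth _ _ (Ordinal hj)).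
elim: (tval t) (thead t) => [|x s IH] z Ps; first by constructor.
by constructor; [apply: (Ps 0)|apply: (IH z) => j; apply: (Ps j.+1)].
Qed.

(** * IN-semigroups give W-monoids *)

Section Adjoining.

Variables (n : nat) (hn : 2 <= n) (X Y : Type) (F : n.-tuple X -> X).
Variables (i : X -> Y) (e : Y) (G : n.-tuple Y -> Y).
Hypotheses (adjG : adjoining F i e G) (irrF : ~ reducible hn F).

Local Notation op := (derived_op G e).

Let opM : is_monoid op e.
Proof. by case: adjG => _ _ _ [_ assG] _ neutG; apply: derived_op_monoid. Qed.

Let Gop t : G t = nary_ext hn op t.
Proof. by case: adjG => _ _ _ [_ assG] _ neutG; apply: nary_ext_derived_op. Qed.

(** A word without e consists of elements of X, and G maps it into X. *)
Lemma adjoining_avoids : avoids_neutral op e n.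
Proof.
case: adjG => inji newi cover _ restr _.
move=> _ /[swap] /(Forall_image cover) [r ->]; rewrite size_map => /eqP hr.
have := restr (Tuple hr).
by rewrite Gop (nary_ext_monoid opM) => ->; apply: newi.
Qed.

(** Otherwise op would restrict to X and reduce F. *)
Lemma adjoining_unit_product : exists a b, [/\ a <> e, b <> e & op a b = e].
Proof.
case: (classic (exists a b, [/\ a <> e, b <> e & op a b = e])) => // noab.
case: adjG => inji newi cover _ restr _.
have [opA _ _] := opM.
case: irrF; apply: (reducible_pullback inji opA) => [x y|t].
  case: (cover (op (i x) (i y))) => [xy|[z ->]]; last by exists z.
  by case: noab; exists (i x), (i y); split.
by rewrite -Gop restr.
Qed.

Theorem adjoining_odd_W_monoid : odd n /\ W_monoid op e.
Proof.
have [a [b [ae be ab]]] := adjoining_unit_product.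
have odd_n := avoids_neutral_odd opM ae be ab adjoining_avoids.
have avoids3 : avoids_neutral op e 3.
  apply: (avoids_neutral_descend opM ae be ab (m := (n - 3)./2)).
  have -> : 3 + (n - 3)./2.*2 = n by lia.
  exact: adjoining_avoids.
have [W1 W2] := avoids3_W_element opM ae be ab avoids3.
split=> //; split=> //; exists a; split=> //.
case: (classic (exists x, op a x <> op x a)) => // central.
have ca y : op a y = op y a.
  by case: (classic (op a y = op y a)) => // ay; case: central; exists y.
have aa : op a a = e by apply/W1; left.
case: adjG => inji newi cover _ restr _.
(* For central a, twist op a reduces F: the n - 1 inserted copies of a cancel
   because n - 1 is even. *)
case: irrF; apply: (reducible_pullback inji (twist_associative opM a)).
  move=> x y; case: (cover (twist op a (i x) (i y))) => [xy|[z ->]]; last first.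
    by exists z.
  have [_ op1 _] := opM.
  case: (avoids3 [:: i x; a; i y]) => //; last by rewrite /= op1.
  by repeat (constructor; first by [|apply: newi]).
move=> t; rewrite -restr Gop.
have [x [s et]] := tuple_gt0_cons (map_tuple i t) (ltnW hn).
rewrite !(nary_ext_val _ _ et) (foldl_twist opM) //.
have -> : odd (size s) = false.
  by have := size_tuple (map_tuple i t); rewrite et /=; lia.
by have [_ _ ->] := opM.
Qed.

End Adjoining.

(** * W-monoids give IN-semigroups *)

Section Converse.

Variables (n : nat) (hn : 2 <= n) (M : Type) (op : M -> M -> M) (e : M).
Hypotheses (opW : W_monoid op e) (odd_n : odd n).

Let opM : is_monoid op e := opW.1.

Lemma W_element_neq a : (exists x, op a x <> op x a) -> a <> e.
Proof.
have [_ op1 opr1] := opM => -[x ax] ae.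
by case: ax; rewrite ae op1 opr1.
Qed.

Lemma W_monoid_closed : closed_under (fun x => x <> e) (nary_ext hn op).
Proof.
case: opW => _ [a [W1 W2 nca]] t te.
have {te} Ht := Forall_tnth (P := fun x => x <> e) te.
rewrite (nary_ext_monoid opM) => te.
have [/(_ te)] := W_element_parity (conj W1 W2) (W_element_neq nca) Ht.
by rewrite size_tuple odd_n.
Qed.

Theorem W_monoid_IN : IN_semigroup hn (restrict_op W_monoid_closed).
Proof.
have [opA op1 opr1] := opM.
case: (opW) => _ [a [W1 W2 nca]]; have ae := W_element_neq nca.
have aa : op a a = e by apply/W1; left.
set F := restrict_op _; pose val_ := @sval M (fun x => x <> e).
have inj_val : injective val_.
  by move=> [x hx] [y hy] /= xy; subst y; rewrite (proof_irrelevance _ hx hy).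
have restr t : nary_ext hn op (map_tuple val_ t) = val_ (F t) by [].
have assM := nary_ext_associative opM hn.
pose a0 : {x | x <> e} := exist _ a ae.
split.
- by split; [exists; exact: a0|apply: associative_pullback inj_val restr assM].
- move=> [opX [opXA FE]]; pose d := nseq_tuple n a0.
  have FM s : size s = n -> val_ (on_seq F d s) = foldl op e (map val_ s).
    move=> hs; rewrite (map_on_seq d (map_tuple val_ d) restr hs).
    by rewrite (monoid_on_seq opM) // size_map.
  have FX x s : size s = n.-1 -> on_seq F d (x :: s) = foldl opX x s.
    move=> hs; rewrite -(nary_ext_on_seq hn opX d) //.
    by rewrite /on_seq FE.
  (* As a * a = e, right multiplication by a power of a depends on parity. *)
  have pow k x : foldl op x (nseq k a) = if odd k then op x a else x.
    elim: k x => //= k IH x; rewrite IH.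
    by case: (odd k) => //=; rewrite -opA aa opr1.
  (* The product of n - 1 copies of a0 for the reducing operation; it is neutral
     because x * a^(n-1) = x = a^(n-1) * x in M. *)
  pose u := foldl opX a0 (nseq n.-2 a0).
  have xu x : opX x u = x.
    rewrite -foldl_op // -[foldl _ _ _]/(foldl opX x (nseq n.-2.+1 a0)).
    apply: inj_val; rewrite -FX ?size_nseq; last lia.
    rewrite FM /= ?size_nseq ?map_nseq; last lia.
    rewrite op1 pow.
    have -> : odd n.-2 = true by lia.
    by rewrite -opA aa opr1.
  have ux x : opX u x = x.
    rewrite -foldl_rcons; apply: inj_val.
    rewrite -FX ?size_rcons ?size_nseq; last lia.
    rewrite FM /= ?size_rcons ?size_nseq ?map_rcons ?map_nseq; last lia.
    rewrite op1 foldl_rcons pow.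
    have -> : odd n.-2 = true by lia.
    by rewrite /= aa op1.
  have uM : is_monoid opX u by split.
  have neutF k x : k < n -> on_seq F d (nseq k u ++ x :: nseq (n.-1 - k) u) = x.
    apply: ((neutral_on_seq F d u).1 _ x k) => y j; rewrite FE.
    exact: (nary_ext_neutral uM).
  (* F(u, ..., u, a) = a forces u^(n-1) = e by (W2), then u = a by (W1). *)
  have ua : u = a0.
    apply: inj_val; have ue : val_ u <> e := svalP u.
    have := neutF n.-1 a0; rewrite subnn => /(_ ltac:(lia)) /(congr1 val_).
    rewrite FM ?size_cat ?size_nseq /=; last lia.
    rewrite map_cat foldl_cat map_nseq /=.
    case/W2 => [[_ /ae //]|[]].
    have -> : n.-1 = n.-2.+1 by lia.
    rewrite -addn1 nseqD foldl_cat /= => /W1 [[]//|[_ /ue]//].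
  case: nca => x; case.
  case: (classic (x = e)) => [->|xe]; first by rewrite op1 opr1.
  (* With u = a, neutrality reads a * x * a^(n-2) = x, where n - 2 is odd. *)
  have := neutF 1 (exist _ x xe); rewrite ua => /(_ ltac:(lia)) /(congr1 val_).
  rewrite FM /= ?size_nseq ?map_nseq /=; last lia.
  rewrite op1 pow.
  have -> : odd (n.-1 - 1) = true by lia.
  by move=> {2}<-; rewrite -!opA aa opr1.
- exists M, val_, e, (nary_ext hn op); split=> //.
  + by move=> x; apply: (svalP x).
  + move=> y; case: (classic (y = e)) => [|ye]; first by left.
    by right; exists (exist _ y ye).
  + exact: nary_ext_neutral opM _ _.
Qed.

End Converse.

(** * The correspondence *)

Theorem theorem3p2 (n : nat) (hn : 2 <= n) :
  (forall (X : Type) (F : n.-tuple X -> X), IN_semigroup hn F ->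
     odd n /\
     forall (Y : Type) (i : X -> Y) (e : Y) (Fs : n.-tuple Y -> Y),
       adjoining F i e Fs ->
       [/\ W_monoid (derived_op Fs e) e,
           forall t : n.-tuple Y, Fs t = nary_ext hn (derived_op Fs e) t
         & forall op : Y -> Y -> Y,
             is_monoid op e ->
             (forall t : n.-tuple Y, Fs t = nary_ext hn op t) ->
             forall x y : Y, op x y = derived_op Fs e x y]) /\
  (forall (M : Type) (op : M -> M -> M) (e : M), W_monoid op e -> odd n ->
     exists hX : closed_under (fun x : M => x <> e) (nary_ext hn op),
       IN_semigroup hn (restrict_op hX)).
Proof.
split=> [X F [_ irrF [Y0 [i0 [e0 [G0 adj0]]]]]|M op e opW odd_n].
  split=> [|Y i e Fs adj]; first exact: (adjoining_odd_W_monoid adj0 irrF).1.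
  split=> [|t|op opM FsE x y].
  - exact: (adjoining_odd_W_monoid adj irrF).2.
  - by case: adj => _ _ _ [_ assFs] _ neutFs; apply: nary_ext_derived_op.
  - by rewrite -(derived_op_nary_ext opM hn) /derived_op FsE.
by exists (@W_monoid_closed n hn M op e opW odd_n); apply: W_monoid_IN.
Qed.
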